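(* There is a family $\mathcal{H}_1$ of $\mathfrak{c}$ many pairwise non-isomorphic Boolean subalgebras of $\wp(\omega)$, each of which is an $\mathbb{F}_{\sigma\delta}$ subset of $2^\omega$, such that each algebra in $\mathcal{H}_1$ has the Nikodym property but not the Grothendieck property.
   Context: $\mathfrak{c}$ denotes the cardinality of the continuum. Subsets of $\omega$ are identified with points of the Cantor space $2^\omega$ via characteristic functions, so families of subsets of $\omega$ (e.g. Boolean subalgebras of $\wp(\omega)$) are subsets of $2^\omega$ and have a Borel class. For a Boolean algebra $\mathcal{A}$, a measure on $\mathcal{A}$ is a finitely additive $\mu\colon\mathcal{A}\to\mathbb{R}$ with finite variation norm $\|\mu\|=\sup\{|\mu(A)|+|\mu(B)|\colon A,B\in\mathcal{A},\ A\wedge B=0\}$; $\mathrm{ba}(\mathcal{A})$ is the Banach space of such measures with this norm. $\mathcal{A}$ has the Nikodym property if every sequence $(\mu_n)$ in $\mathrm{ba}(\mathcal{A})$ with $\lim_n\mu_n(A)=0$ for every $A\in\mathcal{A}$ is norm bounded. $\mathcal{A}$ has the Grothendieck property if every norm bounded sequence $(\mu_n)$ in $\mathrm{ba}(\mathcal{A})$ with $\lim_n\mu_n(A)=0$ for every $A\in\mathcal{A}$ converges to $0$ in the weak topology of the Banach space $\mathrm{ba}(\mathcal{A})$. *)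

(* Defs.v *)
From HB Require Import structures.
From mathcomp Require Import all_boot all_order all_algebra.
From mathcomp Require Import all_classical all_reals all_analysis borel_hierarchy.

Set Implicit Arguments.
Unset Strict Implicit.
Unset Printing Implicit Defensive.

Import Order.TTheory GRing.Theory Num.Theory.
Import numFieldNormedType.Exports.

Local Open Scope classical_set_scope.
Local Open Scope ring_scope.

(* A Boolean algebra is a [ctbDistrLatticeType]. *)

Definition boolalg_isomorphic (d d' : Order.disp_t)
    (A : ctbDistrLatticeType d) (B : ctbDistrLatticeType d') : Prop :=
  exists f : A -> B,
    [/\ bijective f,
        f \bot%O = \bot%O /\ f \top%O = \top%O,
        {morph f : a b / (a `&` b)%O},
        {morph f : a b / (a `|` b)%O} &
        {morph f : a / (~` a)%O}].

Section ba.
Variables (R : realType) (d : Order.disp_t) (A : ctbDistrLatticeType d).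
Implicit Types mu nu : A -> R.

Definition fin_additive mu : Prop :=
  forall a b : A, (a `&` b = \bot)%O -> mu (a `|` b)%O = mu a + mu b.

Definition variations mu : set R :=
  [set r | exists a b : A, (a `&` b = \bot)%O /\ r = `|mu a| + `|mu b|].

Definition variation mu : R := sup (variations mu).

(* The least upper bound of the nonempty set [variations mu] is finite. *)
Definition finite_variation mu : Prop := has_ubound (variations mu).

Definition ba_pred : {pred A -> R} :=
  fun mu => `[< fin_additive mu /\ finite_variation mu >].

Record ba : Type := Ba { ba_fun :> A -> R ; _ : ba_fun \in ba_pred }.

HB.instance Definition _ := [isSub for ba_fun].
HB.instance Definition _ := [Choice of ba by <:].

Lemma variations_has_sup mu : finite_variation mu -> has_sup (variations mu).
Proof.
move=> ?; split => //; exists (`|mu \bot%O| + `|mu \bot%O|).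
by exists \bot%O, \bot%O; rewrite meetxx.
Qed.

Lemma le_variation mu (a b : A) : finite_variation mu ->
  (a `&` b = \bot)%O -> `|mu a| + `|mu b| <= variation mu.
Proof.
by move=> fmu ab; apply: ub_le_sup => //; exists a, b.
Qed.

Lemma variation_le mu (c : R) :
  (forall a b : A, (a `&` b = \bot)%O -> `|mu a| + `|mu b| <= c) ->
  variation mu <= c.
Proof.
move=> h; apply: ge_sup.
  exists (`|mu \bot%O| + `|mu \bot%O|).
  by exists \bot%O, \bot%O; rewrite meetxx.
by move=> _ [a [b [ab ->]]]; exact: h.
Qed.

Lemma variation_addr mu nu (a b : A) :
    finite_variation mu -> finite_variation nu -> (a `&` b = \bot)%O ->
  `|(mu + nu) a| + `|(mu + nu) b| <= variation mu + variation nu.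
Proof.
move=> fmu fnu ab; rewrite !fctE.
apply: (@le_trans _ _ ((`|mu a| + `|nu a|) + (`|mu b| + `|nu b|))).
  by apply: lerD; exact: ler_normD.
by rewrite addrACA lerD// le_variation.
Qed.

Lemma variation_scale (k : R) mu (a b : A) : finite_variation mu ->
  (a `&` b = \bot)%O -> `|(k *: mu) a| + `|(k *: mu) b| <= `|k| * variation mu.
Proof.
move=> fmu ab; rewrite -![(k *: mu) _]/(k * mu _) !normrM -mulrDr.
by rewrite ler_wpM2l// le_variation.
Qed.

Lemma ba_submod_closed : submod_closed ba_pred.
Proof.
split.
  apply/asboolP; split; first by move=> a b _; exact: esym (addr0 0).
  by exists 0 => _ [a [b [_ ->]]]; rewrite -![0 _]/0 normr0 addr0.
move=> k mu nu /asboolP[amu fmu] /asboolP[anu fnu]; apply/asboolP; split.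
  move=> a b ab; rewrite !fctE amu// anu// scalerDr.
  by rewrite addrACA.
exists (`|k| * variation mu + variation nu) => _ [a [b [ab ->]]].
rewrite !fctE.
apply: (@le_trans _ _ ((`|k *: mu a| + `|nu a|) + (`|k *: mu b| + `|nu b|))).
  by apply: lerD; exact: ler_normD.
by rewrite addrACA lerD//; [exact: variation_scale|exact: le_variation].
Qed.

HB.instance Definition _ := GRing.isSubmodClosed.Build R (A -> R) ba_pred
  ba_submod_closed.
HB.instance Definition _ := [SubChoice_isSubLmodule of ba by <:].

Lemma ba_additive (mu : ba) : fin_additive mu.
Proof. by case: mu => mu /= /asboolP[]. Qed.

Lemma ba_finite_variation (mu : ba) : finite_variation mu.
Proof. by case: mu => mu /= /asboolP[]. Qed.

Let ler_variationD (mu nu : ba) :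
  variation (mu + nu : ba) <= variation mu + variation nu.
Proof.
apply: variation_le => a b ab.
by apply: variation_addr => //; exact: ba_finite_variation.
Qed.

Let variationZ (k : R) (mu : ba) :
  variation (k *: mu : ba) = `|k| * variation mu.
Proof.
have le l (nu : ba) : variation (l *: nu : ba) <= `|l| * variation nu.
  apply: variation_le => a b ab.
  by apply: variation_scale => //; exact: ba_finite_variation.
apply/eqP; rewrite eq_le le /=.
have [->|k0] := eqVneq k 0.
  rewrite normr0 mul0r scale0r.
  apply: le_trans (le_variation (ba_finite_variation (0 : ba))
    (meetxx (\bot%O : A))).
  by rewrite addr_ge0.
rewrite -ler_pdivlMl ?normr_gt0// -normfV.
by have := le k^-1 (k *: mu); rewrite scalerA mulVf// scale1r.
Qed.

Let variation_eq0 (mu : ba) : variation mu = 0 -> mu = 0.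
Proof.
move=> mu0; apply: val_inj; apply/funext => a /=.
have := le_variation (ba_finite_variation mu) (meetx0 a).
rewrite mu0 => h.
apply/eqP; rewrite -normr_le0; apply: le_trans h.
by rewrite lerDl.
Qed.

HB.instance Definition _ := Lmodule_isNormed.Build R ba
  ler_variationD variationZ variation_eq0.

Lemma ba_normE (mu : ba) : `|mu| = variation mu.
Proof. by []. Qed.

End ba.

Section weak_topology.
Variables (R : realType) (V : normedModType R).

(* The topological dual of V. *)
Record dual : Type := Dual {
  dual_fun :> {linear V -> R^o} ;
  dual_continuous : continuous dual_fun }.

(* V with the coarsest topology making every element of [dual] continuous. *)
Definition weak : Type :=
  sup_topology (fun f : dual =>
    Topological.class (initial_topology (f : V -> R^o))).

HB.instance Definition _ := Topological.on weak.

Definition weak_cvg (u : nat -> V) (l : V) : Prop :=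
  (u : nat -> weak) @ \oo --> (l : weak).

Lemma weak_cvgP (u : nat -> V) (l : V) :
  weak_cvg u l <-> forall f : dual, f (u n) @[n --> \oo] --> f l.
Proof.
rewrite /weak_cvg cvg_sup; split => h f; have := h f.
  by move=> {}h U /(@initial_continuous _ _ (f : V -> R^o) l) /h.
move=> {}h U [_ [[W oW <-] fl] WU]; apply: filterS WU _.
by apply: h; exact: open_nbhs_nbhs.
Qed.

End weak_topology.

Section properties.
Variables (R : realType) (d : Order.disp_t) (A : ctbDistrLatticeType d).

Definition pointwise_null (mu : nat -> ba R A) : Prop :=
  forall a : A, mu n a @[n --> \oo] --> (0 : R).

Definition norm_bounded (mu : nat -> ba R A) : Prop :=
  exists M : R, forall n, `|mu n| <= M.

Definition Nikodym_property : Prop :=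
  forall mu : nat -> ba R A, pointwise_null mu -> norm_bounded mu.

Definition Grothendieck_property : Prop :=
  forall mu : nat -> ba R A, norm_bounded mu -> pointwise_null mu ->
    weak_cvg mu 0.

End properties.

Definition is_subalgebra (S : set (set nat)) : Prop :=
  [/\ S set0, S setT, setI_closed S, setU_closed S & setC_closed S].

Record subalgebra : Type := Subalgebra {
  carrier :> set (set nat) ;
  subalgebraP : is_subalgebra carrier }.

Section subalgebra_boolalg.
Variable S : subalgebra.

Definition subalgebra_pred : {pred set nat} := fun a => a \in carrier S.

(* The Boolean algebra whose elements are the members of S. *)
Record elements : Type := Element {
  element_val :> set nat ; _ : element_val \in subalgebra_pred }.

HB.instance Definition _ := [isSub for element_val].
HB.instance Definition _ := [Choice of elements by <:].

Let meet_closed :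
  {in subalgebra_pred &, forall a b, (a `&` b)%O \in subalgebra_pred}.
Proof.
by case: (subalgebraP S) => _ _ h _ _ a b /set_mem aS /set_mem bS;
  apply/mem_set/h.
Qed.

Let join_closed :
  {in subalgebra_pred &, forall a b, (a `|` b)%O \in subalgebra_pred}.
Proof.
by case: (subalgebraP S) => _ _ _ h _ a b /set_mem aS /set_mem bS;
  apply/mem_set/h.
Qed.

Let bot_closed : (\bot%O : set nat) \in subalgebra_pred.
Proof. by case: (subalgebraP S) => h _ _ _ _; exact/mem_set. Qed.

Let top_closed : (\top%O : set nat) \in subalgebra_pred.
Proof. by case: (subalgebraP S) => _ h _ _ _; exact/mem_set. Qed.

HB.instance Definition _ := Order.SubChoice_isTBSubLattice.Build
  set_display (set nat) subalgebra_pred set_display elements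
  meet_closed join_closed bot_closed top_closed.

Let meetUl : @left_distributive elements elements Order.meet Order.join.
Proof.
by move=> a b c; apply: val_inj; exact: setIUl.
Qed.

HB.instance Definition _ := Order.Lattice_Meet_isDistrLattice.Build
  set_display elements meetUl.

Let compl_closed (a : elements) : (~` (val a))%O \in subalgebra_pred.
Proof.
case: (subalgebraP S) => _ _ _ _ h; apply/mem_set/h.
exact: set_mem (valP a).
Qed.

Let compl (a : elements) : elements := Element (compl_closed a).

Let joinxC (a : elements) : (a `|` compl a = \top)%O.
Proof. by apply: val_inj; exact: setUCr. Qed.

Let meetxC (a : elements) : (a `&` compl a = \bot)%O.
Proof. by apply: val_inj; exact: setICr. Qed.

HB.instance Definition _ := Order.TBDistrLattice_hasComplement.Build
  set_display elements joinxC meetxC.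

Lemma element_valI (a b : elements) :
  element_val (a `&` b)%O = element_val a `&` element_val b.
Proof. by []. Qed.

Lemma element_valU (a b : elements) :
  element_val (a `|` b)%O = element_val a `|` element_val b.
Proof. by []. Qed.

Lemma element_valC (a : elements) : element_val (~` a)%O = ~` element_val a.
Proof. by []. Qed.

Lemma element_val0 : element_val \bot%O = set0.
Proof. by []. Qed.

Lemma element_val1 : element_val \top%O = setT.
Proof. by []. Qed.

End subalgebra_boolalg.

(* The characteristic functions of the members of S. *)
Definition char_set (S : set (set nat)) : set cantor_space :=
  [set x : cantor_space | S [set n | x n]].

Definition Fsigmadelta {T : topologicalType} (S : set T) : Prop :=
  exists2 F : (set T)^nat, (forall i, Fsigma (F i)) & S = \bigcap_i F i.

(* Main.v *)
(** For an infinite set [D] of naturals let [Z] be the ideal of the sets [A]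
    with [#|A `&` [0, N)| / N --> 0] as [N] runs through [D].  The algebra of
    [D] is [Z] together with the complements of its members.

    Nikodym property: sigma-complete algebras have it, hence a pointwise bounded
    family of measures is uniformly bounded on the subsets of any fixed member
    of [Z].  If it were unbounded on [Z], then discarding initial segments and
    splitting into residue classes would yield members [A k] of density at most
    [2^-k] on which some measure exceeds [k]; their union is in [Z], a
    contradiction.

    Failure of the Grothendieck property: along [D] the uniform probabilities on
    [[0, N)] converge pointwise to the two-valued measure vanishing on [Z], but
    the sum over all singletons is a continuous functional which is 1 on the
    former and 0 on the latter.

    Non-isomorphism: an isomorphism is induced by a permutation of the naturals.
    If [u n / u n.+1 --> 0] and [X `\` Y] is infinite, then any permutation is
    defeated, by diagonalisation, for [D = u @` X] and [u @` Y].  Infinite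
    differences are obtained by indexing with the graphs of the maps
    [q |-> (q < r)] on the rationals, one for each real [r]. *)
Require Import Defs.
From HB Require Import structures.
From mathcomp Require Import all_boot all_order all_algebra.
From mathcomp Require Import all_classical all_reals all_analysis.
From mathcomp Require Import borel_hierarchy.
From mathcomp Require Import zify lra.

Set Implicit Arguments.
Unset Strict Implicit.
Unset Printing Implicit Defensive.

Import Order.Theory GRing.Theory Num.Theory.
Import numFieldNormedType.Exports.

Local Open Scope classical_set_scope.
Local Open Scope ring_scope.

(** * Finitely additive measures on Boolean algebras *)

Section fin_additive.
Variables (R : realType) (d : Order.disp_t) (A : ctbDistrLatticeType d).
Implicit Types a b : A.

Definition pairwise_disjoint (I : eqType) (a : I -> A) : Prop :=
  forall i j, i != j -> (a i `&` a j = \bot)%O.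

Lemma meet_joins_eq0 (I : eqType) (r : seq I) (P : pred I) (a : I -> A) b :
    (forall i, i \in r -> P i -> b `&` a i = \bot)%O ->
  (b `&` \join_(i <- r | P i) a i = \bot)%O.
Proof.
move=> ba0; apply/eqP; rewrite meetC disj_leC; apply/joinsP_seq => i ir Pi.
by rewrite -disj_leC meetC ba0.
Qed.

Section additivity.
Variable mu : A -> R.
Hypothesis mu_additive : fin_additive mu.

Lemma fin_additive0 : mu \bot%O = 0.
Proof. by have := mu_additive (meetxx \bot%O); rewrite joinxx; lra. Qed.

Lemma fin_additiveIB a b : mu a = mu (a `&` b)%O + mu (a `\` b)%O.
Proof. by rewrite -mu_additive ?joinIB// meetIB. Qed.

Lemma fin_additiveC a : mu (~` a)%O = mu \top%O - mu a.
Proof. by rewrite (fin_additiveIB \top%O a) meet1x diff1x addrC addKr. Qed.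

Lemma fin_additive_joins (I : eqType) (r : seq I) (P : pred I) (a : I -> A) :
    uniq r -> pairwise_disjoint a ->
  mu (\join_(i <- r | P i) a i)%O = \sum_(i <- r | P i) mu (a i).
Proof.
move=> + a_disj; elim: r => [_|i r IH /= /andP[ir /IH{}IH]].
  by rewrite !big_nil fin_additive0.
rewrite !big_cons; case: ifP => // _; rewrite mu_additive ?IH//.
by apply: meet_joins_eq0 => j jr _; apply: a_disj; apply: contraNneq ir => ->.
Qed.

Lemma exists_large_summand (n : nat) (a : nat -> A) (c : R) :
    pairwise_disjoint a ->
    n%:R * c < `|mu (\join_(0 <= i < n) a i)%O| ->
  exists2 i, (i < n)%N & c < `|mu (a i)|.
Proof.
move=> a_disj; apply: contraPP => no_large; apply/negP; rewrite -leNgt.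
rewrite fin_additive_joins ?iota_uniq//; apply: le_trans (ler_norm_sum _ _ _) _.
rewrite -[n in n%:R]subn0 mulrC mulr_natr -sumr_const_nat.
apply: ler_sum_nat => i i_lt.
by rewrite leNgt; apply/negP => lt_a; apply: no_large; exists i.
Qed.

Lemma nonneg_additive_ba : (forall a, 0 <= mu a) -> mu \in @ba_pred R d A.
Proof.
move=> mu0; apply/asboolP; split => //; exists (mu \top%O).
move=> _ [a [b [ab ->]]]; rewrite !ger0_norm// -mu_additive//.
by rewrite -[leRHS](subrK (mu (a `|` b)%O)) -fin_additiveC lerDr.
Qed.

End additivity.

Lemma normr_ba_le (mu : ba R A) a : `|mu a| <= `|mu|.
Proof.
have := Defs.le_variation (ba_finite_variation mu) (meetx0 a).
by apply: le_trans; rewrite lerDl.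
Qed.

Lemma sum_normr_ba_le (I : eqType) (r : seq I) (a : I -> A) (mu : ba R A) :
  uniq r -> pairwise_disjoint a -> \sum_(i <- r) `|mu (a i)| <= `|mu|.
Proof.
move=> r_uniq a_disj; pose P := [pred i | 0 <= mu (a i)].
pose join_of (Q : pred I) := (\join_(i <- r | Q i) a i)%O.
have mu_join Q : mu (join_of Q) = \sum_(i <- r | Q i) mu (a i).
  by apply: fin_additive_joins => //; exact: ba_additive.
have -> : \sum_(i <- r) `|mu (a i)| = mu (join_of P) - mu (join_of (predC P)).
  rewrite !mu_join -sumrN (bigID P) /=; congr (_ + _); apply: eq_bigr => i.
    exact: ger0_norm.
  by rewrite -ltNge => /ltr0_norm.
have join_disj : (join_of P `&` join_of (predC P) = \bot)%O.
  apply: meet_joins_eq0 => j _ nPj; rewrite meetC.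
  apply: meet_joins_eq0 => i _ Pi.
  by apply: a_disj; apply: contraNneq nPj => ->.
apply: le_trans (ler_norm _) (le_trans (ler_normB _ _) _).
exact: Defs.le_variation (ba_finite_variation mu) join_disj.
Qed.

Lemma ba_norm_le (mu : ba R A) (c : R) :
  (forall a, `|mu a| <= c) -> `|mu| <= c + c.
Proof.
move=> mu_le; rewrite ba_normE; apply: Defs.variation_le => a b _.
exact: lerD.
Qed.

Lemma ba_comp (d' : Order.disp_t) (B : ctbDistrLatticeType d') (h : B -> A)
    (mu : ba R A) :
    (forall x y, x `&` y = \bot -> h x `&` h y = \bot)%O ->
    {morph h : x y / (x `|` y)%O} ->
  mu \o h \in @ba_pred R d' B.
Proof.
move=> h_disj hU; apply/asboolP; split => [x y xy|].
  by rewrite /= hU (ba_additive mu)// h_disj.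
exists (`|mu| + `|mu|) => _ [x [y [_ ->]]].
by apply: lerD; exact: normr_ba_le.
Qed.

End fin_additive.

Section disjoint_sum.
Variables (R : realType) (d : Order.disp_t) (A : ctbDistrLatticeType d).
Variable a : nat -> A.
Hypothesis a_disj : pairwise_disjoint a.
Implicit Types mu nu : ba R A.

Definition disjoint_sum mu : R^o := limn (series (mu \o a)).

Lemma sum_normr_nat_ba_le mu n : \sum_(0 <= i < n) `|mu (a i)| <= `|mu|.
Proof. exact: sum_normr_ba_le (iota_uniq _ _) a_disj. Qed.

Lemma is_cvg_disjoint_sum mu : cvgn (series (mu \o a) : R^o ^nat).
Proof.
apply: normed_cvg; apply: nondecreasing_is_cvgn.
  by apply: nondecreasing_series => *; exact: normr_ge0.
by exists `|mu| => _ [n _ <-]; exact: sum_normr_nat_ba_le.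
Qed.

Lemma disjoint_sum_is_linear : linear disjoint_sum.
Proof.
move=> k mu nu; apply: cvg_lim => //.
have -> : series ((k *: mu + nu : ba R A) \o a) =
    k *: (series (mu \o a) : R^o ^nat) + series (nu \o a).
  apply/funext => n; rewrite /series /= !fctE scaler_sumr -big_split.
  exact: eq_bigr.
by apply: cvgD; [apply: cvgZr|]; exact: is_cvg_disjoint_sum.
Qed.

HB.instance Definition _ :=
  GRing.isLinear.Build R (ba R A) R^o *:%R disjoint_sum disjoint_sum_is_linear.

Lemma disjoint_sum_le mu : `|disjoint_sum mu| <= `|mu|.
Proof.
have mu_cvg := @is_cvg_disjoint_sum mu.
rewrite /disjoint_sum -lim_norm//; apply: limr_le; first exact: is_cvg_norm.
apply: nearW => n; apply: le_trans (sum_normr_nat_ba_le mu n).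
exact: ler_norm_sum.
Qed.

Lemma continuous_disjoint_sum : continuous disjoint_sum.
Proof.
apply: bounded_linear_continuous; apply/bounded_funP => r; exists r => mu.
exact: le_trans (disjoint_sum_le mu).
Qed.

Definition disjoint_sum_dual : dual (ba R A) := Dual continuous_disjoint_sum.

End disjoint_sum.

(** * Nikodym boundedness on sigma-complete Boolean algebras *)

Definition sigma_complete (d : Order.disp_t) (A : ctbDistrLatticeType d) :
    Prop :=
  forall a : nat -> A,
    exists s : A, forall b, (s <= b)%O <-> (forall n, (a n <= b)%O).

Section sigma_complete_Nikodym.
Variables (R : realType) (d : Order.disp_t) (A : ctbDistrLatticeType d).
Hypothesis A_complete : sigma_complete A.
Variables (I : Type) (mu : I -> ba R A).
Hypothesis mu_bounded : forall a, exists c : R, forall i, `|mu i a| <= c.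
Implicit Types a b u e : A.

Definition unbounded_on a : Prop :=
  forall c : R, exists i b, (b <= a)%O /\ c < `|mu i b|.

Lemma unbounded_on_split a b : unbounded_on a ->
  unbounded_on (a `&` b)%O \/ unbounded_on (a `\` b)%O.
Proof.
move=> a_unb; apply: contrapT => /not_orP[/existsNP[c1 c1P] /existsNP[c2 c2P]].
have [i [e [ea]]] := a_unb (c1 + c2).
rewrite (fin_additiveIB (ba_additive (mu i)) e b) ltNge => /negP; apply.
apply: le_trans (ler_normD _ _) (lerD _ _); rewrite leNgt; apply/negP => lt_mu.
  by apply: c1P; exists i, (e `&` b)%O; rewrite leI2.
by apply: c2P; exists i, (e `\` b)%O; rewrite leBl.
Qed.

Lemma unbounded_on_peel a (c : R) : unbounded_on a ->
  exists i b, [/\ (b <= a)%O, c < `|mu i b| & unbounded_on (a `\` b)%O].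
Proof.
move=> a_unb; have [M muM] := mu_bounded a.
have [i [b [ba lt_b]]] := a_unb (c + M).
have mu_a := muM i.
have mu_ab : mu i a = mu i b + mu i (a `\` b)%O.
  by rewrite (fin_additiveIB (ba_additive (mu i)) a b) meet_r.
have [ab_unb|ab_unb] := unbounded_on_split b a_unb; last first.
  by exists i, b; split => //; have := normr_ge0 (mu i a); lra.
exists i, (a `\` b)%O; split; first exact: leBx.
  by have := ler_normB (mu i a) (mu i (a `\` b)%O); rewrite {1}mu_ab addrK; lra.
by rewrite diffxB diffxx join0x.
Qed.

Lemma unbounded_on_disjoint (K : countType) (c : K -> R) a :
    unbounded_on a ->
  exists (i : K -> I) (b : K -> A),
    [/\ pairwise_disjoint b, forall k, (b k <= a)%O &
        forall k, c k < `|mu (i k) (b k)|].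
Proof.
move=> a_unb; pose c' n := oapp c 0 (unpickle n).
have /choice[f fP] : forall q : nat * {x | unbounded_on x},
    exists r : I * A * {x | unbounded_on x},
    [/\ (r.1.2 <= sval q.2)%O, c' q.1 < `|mu r.1.1 r.1.2| &
        sval r.2 = (sval q.2 `\` r.1.2)%O].
  move=> [n [x x_unb]].
  have [i [b [bx lt_b xb_unb]]] := unbounded_on_peel (c' n) x_unb.
  by exists (i, b, exist _ _ xb_unb).
pose rest := fix rest n :=
  if n is m.+1 then (f (m, rest m)).2 else exist _ a a_unb.
pose b n := (f (n, rest n)).1.2.
have b_rest n : (b n <= sval (rest n))%O by case: (fP (n, rest n)).
have restS n : sval (rest n.+1) = (sval (rest n) `\` b n)%O.
  by case: (fP (n, rest n)).
have rest_dec : {homo sval \o rest : m n / (m <= n)%N >-> (n <= m)%O}.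
  by apply/nonincreasing_seqP => n; rewrite /= restS leBx.
have b_disj_lt m n : (m < n)%N -> (b m `&` b n = \bot)%O.
  move=> /rest_dec; rewrite /= restS => /(le_trans (b_rest n)).
  by rewrite leBRL meetC => /andP[_ /eqP].
exists (fun k => (f (pickle k, rest (pickle k))).1.1), (b \o pickle); split.
- move=> k l; rewrite -(inj_eq (pcan_inj pickleK)) neq_ltn.
  by move=> /orP[] /b_disj_lt //; rewrite meetC.
- by move=> k; apply: le_trans (b_rest _) (rest_dec 0%N _ _).
- by move=> k; case: (fP (pickle k, rest (pickle k))); rewrite /c' pickleK.
Qed.

(* Only finitely many of infinitely many disjoint elements can have a part of
   measure greater than 1. *)
Lemma unbounded_on_small i a : unbounded_on a ->
  exists b, [/\ (b <= a)%O, unbounded_on b &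
    forall e, (e <= b)%O -> `|mu i e| <= 1].
Proof.
pose height (k : nat * nat) : R := k.2%:R.
move=> /(unbounded_on_disjoint height)[j [b [b_disj ba lt_b]]].
have /choice[s sP] := fun n => A_complete (fun k => b (n, k)).
have s_disj : pairwise_disjoint s.
  move=> m n mn; apply/eqP; rewrite disj_leC; apply/sP => k.
  rewrite lexC; apply/sP => l; rewrite lexC -disj_leC b_disj//.
  by apply: contraNneq mn => -[->].
apply: contrapT => no_small.
have /choice[e eP] : forall n, exists e, (e <= s n)%O /\ 1 < `|mu i e|.
  move=> n; apply: contrapT => s_small; apply: no_small; exists (s n); split.
  - by apply/sP => k; exact: ba.
  - move=> c; pose k := (Num.truncn c).+1; exists (j (n, k)), (b (n, k)).
    by split; [exact: (sP n _).1|apply: lt_trans (truncnS_gt c) (lt_b (n, k))].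
  - by move=> e es; rewrite leNgt; apply/negP => lt_e; apply: s_small; exists e.
have e_disj : pairwise_disjoint e.
  move=> m n mn; apply/eqP; rewrite -lex0 -(s_disj _ _ mn).
  by apply: leI2; [have [] := eP m|have [] := eP n].
have := sum_normr_nat_ba_le e_disj (mu i) (Num.truncn `|mu i|).+1.
apply/negP; rewrite -ltNge; apply: lt_le_trans (truncnS_gt _) _.
rewrite -[X in X%:R]subn0 -(sumr_const_nat _ _ 1).
by apply: ler_sum => n _; have [_ /ltW] := eP n.
Qed.

Lemma gliding_hump_step (k : nat) u e :
    (u `&` e = \bot)%O -> unbounded_on e ->
  exists i u' e',
    [/\ (u <= u')%O, (u' `|` e' <= u `|` e)%O, (u' `&` e' = \bot)%O &
    [/\ unbounded_on e', k.+1%:R < `|mu i u'| &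
        forall w, (w <= e')%O -> `|mu i w| <= 1]].
Proof.
move=> ue e_unb; have [M muM] := mu_bounded u.
have [i [b [be lt_b eb_unb]]] := unbounded_on_peel (k.+1%:R + M) e_unb.
have [e' [e'eb e'_unb e'_small]] := unbounded_on_small i eb_unb.
have [e'e /eqP e'b] : (e' <= e)%O /\ (e' `&` b)%O == \bot%O.
  by move: e'eb; rewrite leBRL => /andP.
exists i, (u `|` b)%O, e'; split; first exact: leUl.
- by rewrite !leUx leUl !lexUr.
- rewrite meetUl (meetC b) e'b joinx0; apply/eqP; rewrite -lex0 -ue.
  by rewrite leI2.
split => //; have ub : (u `&` b = \bot)%O by apply/eqP; rewrite -lex0 -ue leI2.
have := muM i; have := ler_normB (mu i (u `|` b)%O) (mu i u).
by rewrite {1}(ba_additive (mu i) ub) addrAC subrr add0r; lra.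
Qed.

Lemma gliding_hump : unbounded_on \top%O ->
  exists (i : nat -> I) (u e : nat -> A), forall k,
    [/\ (u k <= u k.+1)%O, (u k.+1 `|` e k.+1 <= u k `|` e k)%O,
        k.+1%:R < `|mu (i k) (u k.+1)| &
        forall w, (w <= e k.+1)%O -> `|mu (i k) w| <= 1].
Proof.
move=> top_unb.
pose state := {q : A * A | (q.1 `&` q.2 = \bot)%O /\ unbounded_on q.2}.
have /choice[f fP] : forall q : nat * state, exists r : I * state,
    let: (u, e) := sval q.2 in let: (u', e') := sval r.2 in
    [/\ (u <= u')%O, (u' `|` e' <= u `|` e)%O, q.1.+1%:R < `|mu r.1 u'| &
        forall w, (w <= e')%O -> `|mu r.1 w| <= 1].
  move=> [k [[u e] [ue e_unb]]].
  have [i [u' [e' [uu' ue' u'e' [e'_unb lt_u' e'_small]]]]] :=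
    gliding_hump_step k ue e_unb.
  by exists (i, exist _ (u', e') (conj u'e' e'_unb)).
pose st := fix st k := if k is j.+1 then (f (j, st j)).2
  else exist _ (\bot%O, \top%O) (conj (meet0x _) top_unb) : state.
exists (fun k => (f (k, st k)).1), (fst \o sval \o st), (snd \o sval \o st).
move=> k.
by move: (fP (k, st k)) => /=; case: (sval (st k)) => ? ?; case: (sval _).
Qed.

Theorem sigma_complete_Nikodym : exists c : R, forall i, `|mu i| <= c.
Proof.
have [/gliding_hump[i [u [e ueP]]]|/existsNP[c cP]] :=
    pselect (unbounded_on \top%O); last first.
  exists (c + c) => i; apply: ba_norm_le => a.
  rewrite leNgt; apply/negP => lt_a.
  by apply: cP; exists i, a; rewrite lex1.
have u_inc : {homo u : k l / (k <= l)%N >-> (k <= l)%O}.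
  by apply/nondecreasing_seqP => k; have [] := ueP k.
have ue_dec : {homo (fun k => u k `|` e k)%O : k l / (k <= l)%N >-> (l <= k)%O}.
  by apply/nonincreasing_seqP => k; have [] := ueP k.
have [v vP] := A_complete u; have [M muM] := mu_bounded v.
pose k := (Num.truncn M).+1; have [_ _ lt_u small_e] := ueP k.
have uv : (u k.+1 <= v)%O by exact: (vP v).1.
have tail_e : (v `\` u k.+1 <= e k.+1)%O.
  rewrite leBLR; apply/vP => l; have [kl|/ltnW lk] := leqP k.+1 l.
    by apply: le_trans (ue_dec _ _ kl); exact: leUl.
  by apply: lexUl; exact: u_inc.
have mu_v : mu (i k) v = mu (i k) (u k.+1) + mu (i k) (v `\` u k.+1)%O.
  by rewrite (fin_additiveIB (ba_additive (mu (i k))) v (u k.+1)) meet_r.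
have := ler_normB (mu (i k) v) (mu (i k) (v `\` u k.+1)%O).
rewrite {1}mu_v addrK.
have := small_e _ tail_e; have := muM (i k); have := truncnS_gt M.
by move: lt_u; rewrite -natr1 -/k; lra.
Qed.

End sigma_complete_Nikodym.

Lemma sigma_complete_set (T : Type) : sigma_complete (set T).
Proof.
move=> A; exists (\bigcup_n A n) => B; split => [AB n|AB].
  by apply: le_trans AB; apply/subsetPset => x Anx; exists n.
by apply/subsetPset; apply: bigcup_sub => n _; apply/subsetPset.
Qed.

(** * Algebras of sets of naturals *)

Section singletons.
Variable S : subalgebra.
Hypothesis S_set1 : forall i, carrier S [set i].
Implicit Types a b : elements S.

Lemma elements_leP a b : reflect (element_val a `<=` element_val b) (a <= b)%O.
Proof.
rewrite leEmeet; apply: (iffP eqP) => [<- x []//|/setIidPl ab].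
exact: val_inj.
Qed.

Lemma elements_neq0P a : a <> \bot%O <-> exists i, element_val a i.
Proof.
split => [a_neq0|[i ai] a0]; last by move: ai; rewrite a0.
by apply/set0P/eqP => a0; apply: a_neq0; exact: val_inj.
Qed.

Definition singleton (i : nat) : elements S := Element (mem_set (S_set1 i)).

Lemma singleton_inj : injective singleton.
Proof. by move=> i j [] ij; have : [set i] i by []; rewrite ij. Qed.

Lemma singleton_le i a : (singleton i <= a)%O <-> element_val a i.
Proof. by split => [/elements_leP|ai]; [exact|apply/elements_leP => _ ->]. Qed.

Lemma singleton_disjoint : pairwise_disjoint singleton.
Proof.
move=> i j /eqP ij; apply: val_inj; apply/seteqP; split => // x [/= xi xj].
by apply: ij; rewrite -xi.
Qed.

End singletons.

Definition set_ideal (T : Type) (Z : set (set T)) : Prop :=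
  [/\ Z set0, forall A B, A `<=` B -> Z B -> Z A & setU_closed Z].

Lemma pairwise_disjoint_fibers (T : Type) (I : eqType) (f : T -> I) :
  pairwise_disjoint (fun i => f @^-1` [set i]).
Proof.
move=> i j /eqP ij; apply/seteqP; split => // x [/= fi fj].
by apply: ij; rewrite -fi.
Qed.

Lemma joins_fibers (T : Type) (f : T -> nat) (n : nat) :
    (forall x, (f x < n)%N) ->
  (\join_(0 <= i < n) f @^-1` [set i])%O = setT.
Proof.
move=> f_lt; apply/seteqP; split => // x _; pose fiber i := f @^-1` [set i].
have /subsetPset/(_ x) : (fiber (f x) <= \join_(0 <= i < n) fiber i)%O.
  by apply: joins_sup_seq; rewrite ?mem_index_iota ?f_lt.
by apply.
Qed.

Section ideal_algebra.
Variable Z : set (set nat).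
Hypothesis Z_ideal : set_ideal Z.

Lemma sub_ideal A B : A `<=` B -> Z B -> Z A.
Proof. by case: Z_ideal => _ + _; apply. Qed.

Lemma ideal_carrier_is_subalgebra : is_subalgebra [set A | Z A \/ Z (~` A)].
Proof.
case: Z_ideal => Z0 _ ZU; split => [||A B|A B|A].
- by left.
- by right; rewrite setCT.
- move=> [ZA|ZA]; first by left; exact: sub_ideal ZA.
  move=> [ZB|ZB]; first by left; exact: sub_ideal ZB.
  by right; rewrite setCI; exact: ZU.
- move=> [ZA|ZA]; last by right; rewrite setCU; exact: sub_ideal ZA.
  move=> [ZB|ZB]; last by right; rewrite setCU; exact: sub_ideal ZB.
  by left; exact: ZU.
- by move=> [ZA|ZA]; [right; rewrite setCK|left].
Qed.

Definition ideal_algebra : subalgebra := Subalgebra ideal_carrier_is_subalgebra.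

Lemma ideal_algebraP (a : elements ideal_algebra) : Z a \/ Z (~` a).
Proof. exact: set_mem (valP a). Qed.

Definition ideal_element (A : set nat) (ZA : Z A) : elements ideal_algebra :=
  Element (mem_set (or_introl ZA)).

Definition ideal_trace (B : set nat) (ZB : Z B) (A : set nat) :
    elements ideal_algebra :=
  ideal_element (sub_ideal (@subIsetl _ B A) ZB).

Lemma ideal_trace_id (B : set nat) (ZB : Z B) (a : elements ideal_algebra) :
  a `<=` B -> ideal_trace ZB a = a.
Proof. by move=> aB; apply: val_inj; exact: setIidr. Qed.

Section Nikodym.
Variables (R : realType) (I : Type) (mu : I -> ba R (elements ideal_algebra)).
Hypothesis mu_bounded : forall a, exists c : R, forall i, `|mu i a| <= c.

Lemma ideal_trace_ba B (ZB : Z B) i :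
  mu i \o ideal_trace ZB \in @ba_pred R _ (set nat).
Proof.
apply: ba_comp => [A1 A2 A12|A1 A2]; apply: val_inj; last exact: setIUr.
rewrite -[LHS]/((B `&` A1) `&` (B `&` A2)) -setIIr.
by rewrite -[A1 `&` A2]/(A1 `&` A2)%O A12; exact: setI0.
Qed.

Lemma bounded_on_ideal_element B : Z B ->
  exists c : R,
    forall i (a : elements ideal_algebra), a `<=` B -> `|mu i a| <= c.
Proof.
move=> ZB; have [A|c cP] := sigma_complete_Nikodym (@sigma_complete_set nat)
  (mu := fun i => Ba (ideal_trace_ba ZB i)); first exact: mu_bounded.
exists c => i a aB; rewrite -(ideal_trace_id ZB aB).
exact: le_trans (normr_ba_le (Ba (ideal_trace_ba ZB i)) (element_val a)) (cP i).
Qed.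

(* [f k] is a colouring of the naturals with finitely many colours, and [F k] is
   a set that may be neglected. *)
Variables (F : nat -> set nat) (n : nat -> nat) (f : nat -> nat -> nat).
Hypothesis ZF : forall k, Z (F k).
Hypothesis f_lt : forall k x, (f k x < n k)%N.
Hypothesis Z_bigcup : forall A : nat -> set nat, (forall k, Z (A k)) ->
  (forall k, exists r, A k `<=` f k @^-1` [set r] `\` F k) -> Z (\bigcup_k A k).

Lemma exists_large_monochromatic k :
    (forall c : R,
      exists i (a : elements ideal_algebra), Z a /\ c < `|mu i a|) ->
  exists i (a : elements ideal_algebra) r,
    [/\ Z a, a `<=` f k @^-1` [set r] `\` F k & k%:R < `|mu i a|].
Proof.
move=> mu_unb; have [c cP] := bounded_on_ideal_element (ZF k).
have [i [a [Za lt_a]]] := mu_unb (c + (n k)%:R * k%:R).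
have ZaF : Z (a `\` F k) by apply: sub_ideal Za; exact: subDsetl.
have lt_aF : (n k)%:R * k%:R < `|mu i (ideal_element ZaF)|.
  pose b := ideal_element (ZF k).
  have -> : ideal_element ZaF = (a `\` b)%O by exact: val_inj.
  have := cP i (a `&` b)%O (@subIsetr _ a (F k)).
  have := ler_normD (mu i (a `&` b)%O) (mu i (a `\` b)%O).
  by rewrite -(fin_additiveIB (ba_additive _)); lra.
pose nu := Ba (ideal_trace_ba ZaF i).
have trace_setT : ideal_trace ZaF setT = ideal_element ZaF.
  by apply: val_inj; exact: setIT.
have [|r _ lt_r] := exists_large_summand (ba_additive nu)
    (pairwise_disjoint_fibers (f k)) (n := n k) (c := k%:R).
  by rewrite joins_fibers//= trace_setT.
exists i, (ideal_trace ZaF (f k @^-1` [set r])), r; split => //.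
  exact: sub_ideal (@subIsetl _ _ _) ZaF.
by move=> x [[_ nFx] fx].
Qed.

Theorem ideal_algebra_norm_bounded : exists c : R, forall i, `|mu i| <= c.
Proof.
suff [c cP] : exists c : R,
    forall i (a : elements ideal_algebra), Z a -> `|mu i a| <= c.
  have [M muM] := mu_bounded \top%O.
  exists ((M + c) + (M + c)) => i; apply: ba_norm_le => a; have := muM i.
  have [Za|Za] := ideal_algebraP a.
    by have := cP i a Za; have := normr_ge0 (mu i \top%O); lra.
  have := cP i (~` a)%O Za; have := ler_normB (mu i \top%O) (mu i (~` a)%O).
  by rewrite {1}(fin_additiveC (ba_additive (mu i))) subKr; lra.
apply: contrapT => no_bound.
have mu_unb (c : R) :
    exists i (a : elements ideal_algebra), Z a /\ c < `|mu i a|.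
  apply: contrapT => c_bound; apply: no_bound; exists c => i a Za.
  by rewrite leNgt; apply/negP => lt_a; apply: c_bound; exists i, a.
have /choice[i /choice[a aP]] := fun k => exists_large_monochromatic k mu_unb.
have Z_union : Z (\bigcup_k a k).
  by apply: Z_bigcup => k; have [r []] := aP k => // ? ? _; exists r.
have [c cP] := bounded_on_ideal_element Z_union.
pose k := (Num.truncn c).+1; have [r [_ _ lt_a]] := aP k.
have ak_sub : a k `<=` \bigcup_k a k by move=> x; exists k.
have := cP (i k) (a k) ak_sub; apply/negP; rewrite -ltNge.
exact: lt_trans (truncnS_gt c) lt_a.
Qed.

End Nikodym.
End ideal_algebra.

(** * Failure of the Grothendieck property *)

Lemma Grothendieck_cvg_dual (R : realType) (d : Order.disp_t)
    (A : ctbDistrLatticeType d)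
    (mu : nat -> ba R A) (nu : ba R A) (phi : dual (ba R A)) :
    Grothendieck_property R A -> norm_bounded mu ->
    (forall a, mu n a @[n --> \oo] --> nu a) ->
  phi (mu n) @[n --> \oo] --> phi nu.
Proof.
move=> G [M muM] mu_nu; apply/subr_cvg0.
have /weak_cvgP/(_ phi) : weak_cvg (fun n => mu n - nu) 0.
  apply: G; first exists (M + `|nu|) => n.
    exact: le_trans (ler_normB _ _) (lerD _ _).
  by move=> a; apply/subr_cvg0; exact: mu_nu.
rewrite linear0; apply: cvg_trans; apply: near_eq_cvg.
by apply: nearW => n; rewrite linearB.
Qed.

Section ideal_algebra_not_Grothendieck.
Variables (R : realType) (Z : set (set nat)).
Hypotheses (Z_ideal : set_ideal Z) (Z_proper : ~ Z setT).
Hypothesis Z_set1 : forall i, Z [set i].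
Local Notation S := (elements (ideal_algebra Z_ideal)).

Lemma proper_idealC A : Z A -> ~ Z (~` A).
Proof.
case: Z_ideal => _ _ ZU ZA ZCA; apply: Z_proper.
by rewrite -(setUv A); exact: ZU.
Qed.

Definition coideal_dirac (a : S) : R := (`[< Z (~` a) >])%:R.

Lemma coideal_dirac0 (a : S) : Z a -> coideal_dirac a = 0.
Proof. by move=> /proper_idealC nZ; rewrite /coideal_dirac asboolF. Qed.

Lemma coideal_dirac1 (a : S) : Z (~` a) -> coideal_dirac a = 1.
Proof. by move=> ZCa; rewrite /coideal_dirac asboolT. Qed.

Lemma coideal_dirac_additive : fin_additive coideal_dirac.
Proof.
have [_ _ ZU] := Z_ideal.
move=> a b ab; have ab0 : element_val a `&` element_val b = set0.
  by rewrite -element_valI ab.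
have b_aC : element_val b `<=` ~` a by apply/disjoints_subset; rewrite setIC.
have a_bC : element_val a `<=` ~` b by exact/disjoints_subset.
have [Za|ZCa] := ideal_algebraP a; last first.
  rewrite (coideal_dirac1 ZCa).
  rewrite (coideal_dirac0 (sub_ideal Z_ideal b_aC ZCa)) addr0.
  by rewrite coideal_dirac1// element_valU setCU; apply: sub_ideal ZCa.
rewrite (coideal_dirac0 Za) add0r; have [Zb|ZCb] := ideal_algebraP b.
  by rewrite !coideal_dirac0// element_valU; exact: ZU.
by rewrite !coideal_dirac1// element_valU setCU; apply: sub_ideal ZCb.
Qed.

Lemma coideal_dirac_ba : coideal_dirac \in @ba_pred R _ S.
Proof. exact: nonneg_additive_ba coideal_dirac_additive (fun=> ler0n _ _). Qed.

Lemma ideal_algebra_set1 i : carrier (ideal_algebra Z_ideal) [set i].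
Proof. by left; exact: Z_set1. Qed.

Theorem ideal_algebra_not_Grothendieck (mu : nat -> ba R S) :
    norm_bounded mu -> (forall a : S, Z a -> mu n a @[n --> \oo] --> 0) ->
    (forall n, mu n \top%O = 1) ->
    (forall n, disjoint_sum (singleton ideal_algebra_set1) (mu n) = 1) ->
  ~ Grothendieck_property R S.
Proof.
move=> mu_bounded mu_Z mu1 mu_atoms G; pose dirac := Ba coideal_dirac_ba.
have mu_dirac a : mu n a @[n --> \oo] --> dirac a.
  have [Za|ZCa] := ideal_algebraP a.
    by rewrite /= coideal_dirac0//; exact: mu_Z.
  rewrite /= coideal_dirac1//.
  have -> : (fun n => mu n a) = (fun n => 1 - mu n (~` a)%O).
    apply/funext => n.
    by rewrite (fin_additiveC (ba_additive (mu n))) mu1 subKr.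
  rewrite -[X in _ --> X]subr0; apply: cvgB; first exact: cvg_cst.
  by apply: mu_Z; rewrite element_valC.
pose phi := disjoint_sum_dual R (@singleton_disjoint _ ideal_algebra_set1).
have phi_mu : (fun n => phi (mu n)) = (fun=> 1) by apply/funext.
have phi_dirac : phi dirac = 0.
  apply: cvg_lim => //; apply: cvg_near_cst; apply: nearW => n.
  by rewrite /series /= big1// => i _; apply: coideal_dirac0; exact: Z_set1.
have := Grothendieck_cvg_dual (phi := phi) G mu_bounded mu_dirac.
rewrite phi_mu phi_dirac => /(norm_cvg_unique (cvg_cst _)) /eqP.
by rewrite oner_eq0.
Qed.

End ideal_algebra_not_Grothendieck.

(** * Density along a set of naturals *)

Definition count_below (A : set nat) (N : nat) : nat :=
  count (mem A) (iota 0 N).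

Definition residue_class (d r : nat) : set nat := [set i | (i %% d)%N = r].

Section count_below.
Implicit Types A B : set nat.

Lemma leq_count_below_inj (p : nat -> nat) A B M N : {in A &, injective p} ->
    (forall i, A i -> (i < M)%N -> B (p i) /\ (p i < N)%N) ->
  (count_below A M <= count_below B N)%N.
Proof.
move=> p_inj pAB; rewrite /count_below -!size_filter -(size_map p).
apply: uniq_leq_size => [|_ /mapP[i + ->]].
  rewrite map_inj_in_uniq ?filter_uniq ?iota_uniq// => i j.
  by rewrite !mem_filter => /andP[Ai _] /andP[Aj _]; exact: p_inj.
rewrite !mem_filter !mem_iota => /andP[/set_mem Ai iM].
by have [/mem_set Bpi pi_lt] := pAB i Ai iM; apply/andP.
Qed.

Lemma leq_count_below A B N : (forall i, A i -> (i < N)%N -> B i) ->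
  (count_below A N <= count_below B N)%N.
Proof.
move=> AB; apply: (@leq_count_below_inj id) => // i Ai iN.
by split => //; exact: AB.
Qed.

Lemma sub_count_below A B N : A `<=` B ->
  (count_below A N <= count_below B N)%N.
Proof. by move=> AB; apply: leq_count_below => i /AB. Qed.

Lemma count_belowT N : count_below setT N = N.
Proof.
rewrite /count_below (eq_count (a2 := predT)) ?count_predT ?size_iota// => i.
by rewrite /= in_setT.
Qed.

Lemma count_below_le A N : (count_below A N <= N)%N.
Proof. by rewrite -[leqRHS]count_belowT sub_count_below. Qed.

Lemma count_below0 N : count_below set0 N = 0%N.
Proof.
rewrite /count_below (eq_count (a2 := pred0)) ?count_pred0// => i.
by rewrite /= in_set0.
Qed.

Lemma count_below1 i N : count_below [set i] N = (i < N)%N.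
Proof.
rewrite /count_below (eq_count (a2 := pred1 i)) => [|j].
  by rewrite count_uniq_mem ?iota_uniq// mem_iota.
by rewrite /= in_set1.
Qed.

Lemma count_belowUI A B N :
  (count_below (A `|` B) N + count_below (A `&` B) N =
   count_below A N + count_below B N)%N.
Proof.
rewrite /count_below -[RHS]count_predUI; congr (_ + _)%N; apply: eq_count => i.
  exact: in_setU.
exact: in_setI.
Qed.

Lemma count_belowU A B N :
  (count_below (A `|` B) N <= count_below A N + count_below B N)%N.
Proof. by rewrite -count_belowUI leq_addr. Qed.

Lemma count_below_disjointU A B N : A `&` B = set0 ->
  count_below (A `|` B) N = (count_below A N + count_below B N)%N.
Proof. by move=> AB; rewrite -count_belowUI AB count_below0 addn0. Qed.

Lemma count_belowC A N : (count_below A N + count_below (~` A) N = N)%N.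
Proof. by rewrite -count_below_disjointU ?setICr// setUv count_belowT. Qed.

Lemma count_below_bigcup (A : nat -> set nat) (i j N : nat) :
  (count_below (\bigcup_(k in [set` index_iota i j]) A k) N <=
   \sum_(i <= k < j) count_below (A k) N)%N.
Proof.
rewrite bigcup_seq; elim/big_rec2 : _ => [|k m B _ B_le].
  by rewrite count_below0.
exact: leq_trans (count_belowU _ _ _) (leq_add _ _).
Qed.

Lemma count_below_finite A : finite_set A ->
  exists M, forall N, (count_below A N <= M)%N.
Proof.
move=> /finite_seqP[s ->]; exists (size s) => N.
rewrite /count_below -size_filter.
apply: uniq_leq_size; first by rewrite filter_uniq// iota_uniq.
by move=> i; rewrite mem_filter => /andP[/set_mem].
Qed.

Lemma count_below_residue (d r N : nat) : (0 < d)%N ->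
  (d * count_below (residue_class d r) N <= N + d)%N.
Proof.
move=> d_gt0; apply: (@leq_trans (d * (N %/ d).+1)); last first.
  by rewrite mulnS addnC leq_add2r mulnC leq_divM.
rewrite leq_mul2l -[(N %/ d).+1]count_belowT; apply/orP; right.
apply: (@leq_count_below_inj (divn^~ d)) => [i j|i _ iN].
  move=> /set_mem /= ir /set_mem /= jr ij.
  by rewrite (divn_eq i d) (divn_eq j d) ij ir jr.
by split => //; rewrite ltnS leq_div2r// ltnW.
Qed.

Lemma count_below_residue_tail A (d r N : nat) : (0 < d)%N ->
    A `<=` residue_class d r -> (forall i, A i -> (d <= i)%N) ->
  (d * count_below A N <= 2 * N)%N.
Proof.
move=> d_gt0 A_sub A_ge; have [dN|Nd] := leqP d N.
  have := count_below_residue r N d_gt0; have := sub_count_below N A_sub.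
  by nia.
suff -> : count_below A N = 0%N by rewrite muln0.
apply/eqP; rewrite -leqn0 -(count_below0 N) leq_count_below// => i /A_ge di iN.
by have := leq_ltn_trans di iN; lia.
Qed.

End count_below.

Lemma infinite_set_near (D P : set nat) : infinite_set D ->
  (\forall N \near \oo, P N) -> exists2 N, D N & P N.
Proof.
move=> D_inf [M _ MP]; apply: contrapT => noN; apply: D_inf.
apply: (sub_finite_set _ (finite_II M)) => N DN; rewrite /= ltnNge.
by apply/negP => /MP PN; apply: noN; exists N.
Qed.

Lemma geometric_sum_le (c : nat -> nat) (N i j : nat) :
    (forall k, (2 ^ k * c k <= N)%N) ->
  (2 ^ i * \sum_(i <= k < j) c k <= 2 * N)%N.
Proof.
move=> c_le; have [ij|ji] := leqP i j; last by rewrite big_geq ?muln0// ltnW.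
rewrite -(subnKC ij); move: (j - i)%N => n {ij}; elim: n i => [|n IH] i.
  by rewrite addn0 big_geq ?muln0.
rewrite big_ltn ?addnS ?ltnS ?leq_addr// -addSn.
have := IH i.+1; have := c_le i.
by rewrite expnS; nia.
Qed.

(* In integers, [count_below A N / N] tends to 0 as [N] runs through [D]. *)
Definition density_zero (D A : set nat) : Prop :=
  forall k, \forall N \near \oo, D N -> (k * count_below A N <= N)%N.

Section density_zero.
Variable D : set nat.

Lemma density_zero_finite A : finite_set A -> density_zero D A.
Proof.
move=> /count_below_finite[M AM] k; near=> N => _.
apply: (@leq_trans (k * M)); last by near: N; exact: nbhs_infty_ge.
by rewrite leq_mul2l AM orbT.
Unshelve. all: by end_near. Qed.

Lemma density_zero_is_ideal : set_ideal (density_zero D).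
Proof.
split => [|A B AB ZB k|A B ZA ZB k]; first exact: density_zero_finite.
  apply: filterS (ZB k) => N BN /BN; apply: leq_trans.
  by rewrite leq_mul2l sub_count_below// orbT.
apply: filterS2 (ZA (2 * k)%N) (ZB (2 * k)%N) => N AN BN DN.
by have := count_belowU A B N; move: (AN DN) (BN DN); nia.
Qed.

Lemma density_zero_proper : infinite_set D -> ~ density_zero D setT.
Proof.
move=> D_inf ZT.
have [N DN [/(_ DN)]] :=
  infinite_set_near D_inf (filterI (ZT 2%N) (nbhs_infty_gt 0)).
by rewrite count_belowT; lia.
Qed.

(* A union of sets of density at most [2^-k] splits at [k = j] into a finite
   union and a tail of density at most [2^(1-j)]. *)
Lemma density_zero_bigcup (A : nat -> set nat) :
    (forall k, density_zero D (A k)) -> (forall k i, A k i -> (k <= i)%N) ->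
    (forall k N, (2 ^ k * count_below (A k) N <= N)%N) ->
  density_zero D (\bigcup_k A k).
Proof.
move=> ZA A_ge A_le k; have [Z0 _ ZU] := density_zero_is_ideal.
pose j := (4 * k)%N; pose part i l := \bigcup_(m in [set` index_iota i l]) A m.
have Z_head : density_zero D (part 0%N j).
  by rewrite /part bigcup_seq; elim/big_rec : _ => // m B _; exact: ZU.
apply: filterS (Z_head (2 * k)%N) => N head_N DN.
have head_le : (2 * k * count_below (part 0 j) N <= N)%N by exact: head_N.
have tail_le : (2 ^ j * count_below (part j N) N <= 2 * N)%N.
  apply: leq_trans (geometric_sum_le j N (fun m => A_le m N)).
  by rewrite leq_mul2l count_below_bigcup orbT.
have split_le : (count_below (\bigcup_m A m) N <=
    count_below (part 0 j) N + count_below (part j N) N)%N.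
  apply: leq_trans (count_belowU _ _ _).
  apply: leq_count_below => i [m _ Ami] iN; have mi := A_ge m i Ami.
  have [mj|jm] := ltnP m j; [left|right];
    by exists m; rewrite //= mem_index_iota; lia.
have : (4 * k <= 2 ^ j)%N by apply: ltnW; rewrite ltn_expl.
by move: (count_below _ _) (count_below _ _) (count_below _ _) (2 ^ _)%N
  head_le tail_le split_le => x y z e; nia.
Qed.

Definition density_algebra : subalgebra := ideal_algebra density_zero_is_ideal.

Theorem density_algebra_Nikodym (R : realType) :
  Nikodym_property R (elements density_algebra).
Proof.
move=> mu mu0; pose d k := (2 ^ k.+1)%N; pose F k := `I_(maxn k (d k)).
have d_gt0 k : (0 < d k)%N by rewrite expn_gt0.
have mu_bounded a : exists c : R, forall n, `|mu n a| <= c.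
  have [M [_ muM]] := cvg_seq_bounded (cvgP _ (mu0 a)).
  by exists (M + 1) => n; apply: (muM (M + 1)) => //; rewrite ltrDl.
apply: (ideal_algebra_norm_bounded mu_bounded (F := F) (n := d)
  (f := fun k i => (i %% d k)%N)).
- by move=> k; apply: density_zero_finite; exact: finite_II.
- by move=> k i; rewrite ltn_mod d_gt0.
move=> A ZA /choice[r A_sub].
have A_ge k i : A k i -> (maxn k (d k) <= i)%N.
  by move=> /A_sub[_ /= /negP]; rewrite -leqNgt.
apply: density_zero_bigcup => // [k i /A_ge|k N].
  by rewrite geq_max => /andP[].
suff : (d k * count_below (A k) N <= 2 * N)%N.
  by rewrite /d expnS -mulnA leq_pmul2l.
apply: (count_below_residue_tail (r := r k)) => // i Ai.
  exact: (A_sub k i Ai).1.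
by move: (A_ge k i Ai); rewrite geq_max => /andP[].
Qed.

End density_zero.

Section uniform_measure.
Variables (R : realType) (S : subalgebra).

Definition uniform_measure (N : nat) (a : elements S) : R :=
  (count_below a N)%:R / N%:R.

Lemma uniform_measure_ge0 N a : 0 <= uniform_measure N a.
Proof. by rewrite divr_ge0. Qed.

Lemma uniform_measureT N : (0 < N)%N -> uniform_measure N \top%O = 1.
Proof.
move=> N_gt0; rewrite /uniform_measure element_val1 count_belowT divff//.
by rewrite pnatr_eq0 -lt0n.
Qed.

Lemma uniform_measure_le1 N a : uniform_measure N a <= 1.
Proof.
have [->|N_gt0] := posnP N; first by rewrite /uniform_measure invr0 mulr0.
by rewrite ler_pdivrMr ?ltr0n// mul1r ler_nat count_below_le.
Qed.

Lemma uniform_measure_additive N : fin_additive (uniform_measure N).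
Proof.
move=> a b ab; rewrite /uniform_measure -mulrDl -natrD -count_below_disjointU//.
by rewrite -element_valI ab.
Qed.

Lemma uniform_measure_ba N : uniform_measure N \in @ba_pred R _ (elements S).
Proof.
exact: nonneg_additive_ba (@uniform_measure_additive N) (uniform_measure_ge0 N).
Qed.

Lemma uniform_measure_norm_bounded (N : nat -> nat) :
  norm_bounded (fun n => Ba (uniform_measure_ba (N n))).
Proof.
exists (1 + 1) => n; apply: ba_norm_le => a /=.
by rewrite ger0_norm ?uniform_measure_ge0// uniform_measure_le1.
Qed.

Lemma disjoint_sum_uniform_measure (S_set1 : forall i, carrier S [set i]) N :
  (0 < N)%N -> disjoint_sum (singleton S_set1) (Ba (uniform_measure_ba N)) = 1.
Proof.
move=> N_gt0; apply: cvg_lim => //; apply: cvg_near_cst.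
exists N => // M /= NM.
rewrite /series /= -mulr_suml -natr_sum.
under eq_bigr do rewrite count_below1.
rewrite (big_cat_nat (n := N))//= [X in (_ + X)%N]big_nat_cond.
rewrite [X in (_ + X)%N]big1 ?addn0.
  rewrite (eq_big_nat _ _ (F2 := fun=> 1%N)) => [|i /andP[_ ->]//].
  by rewrite sum_nat_const_nat subn0 muln1 divff// pnatr_eq0 -lt0n.
by move=> i /andP[/andP[Ni _] _]; rewrite ltnNge Ni.
Qed.

Lemma cvg_uniform_measure0 (D : set nat) (N : nat -> nat) (a : elements S) :
    (forall n, D (N n)) -> (forall n, (n < N n)%N) -> density_zero D a ->
  uniform_measure (N n) a @[n --> \oo] --> 0.
Proof.
move=> DN nN Za; apply/cvgr0Pnorm_le => e e_gt0.
have [m _ a_le] := Za (Num.truncn e^-1).+1; exists m => // n /= mn.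
have N_gt0 : (0 < N n)%N by exact: leq_ltn_trans (nN n).
rewrite ger0_norm ?uniform_measure_ge0// ler_pdivrMr ?ltr0n// -ler_pdivrMl//.
have := a_le (N n) (leq_trans mn (ltnW (nN n))) (DN n).
rewrite -(ler_nat R) natrM; apply: le_trans.
by rewrite ler_wpM2r// ltW// truncnS_gt.
Qed.

End uniform_measure.

Theorem density_algebra_not_Grothendieck (R : realType) (D : set nat) :
  infinite_set D -> ~ Grothendieck_property R (elements (density_algebra D)).
Proof.
move=> D_inf.
have Z_set1 i : density_zero D [set i] by exact: density_zero_finite.
have /choice[N NP] n : exists N, D N /\ (n < N)%N.
  by have [N DN nN] := infinite_set_near D_inf (nbhs_infty_gt n); exists N.
have N_gt0 n : (0 < N n)%N by have [_] := NP n; exact: leq_ltn_trans.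
apply: (ideal_algebra_not_Grothendieck (density_zero_proper D_inf)
  (Z_set1 := Z_set1)
  (mu := fun n => Ba (uniform_measure_ba R (density_algebra D) (N n)))).
- exact: uniform_measure_norm_bounded.
- by move=> a; apply: cvg_uniform_measure0 => n; have [] := NP n.
- by move=> n; exact: uniform_measureT.
- by move=> n; exact: disjoint_sum_uniform_measure.
Qed.

(** * Borel class *)

Section Borel_class.
Variable T : topologicalType.
Implicit Types S : set T.

Lemma FsigmaU S1 S2 : Fsigma S1 -> Fsigma S2 -> Fsigma (S1 `|` S2).
Proof.
move=> [F F_closed ->] [G G_closed ->]; rewrite -bigcupU.
by exists (fun i => F i `|` G i) => // i; exact: closedU.
Qed.

Lemma FsigmadeltaU S1 S2 :
  Fsigmadelta S1 -> Fsigmadelta S2 -> Fsigmadelta (S1 `|` S2).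
Proof.
move=> [F F_sigma ->] [G G_sigma ->].
pose pair n : nat * nat := odflt (0, 0)%N (unpickle n).
exists (fun n => F (pair n).1 `|` G (pair n).2) => [n|]; first exact: FsigmaU.
apply/seteqP; split => [x [Fx n _|Gx n _]|x FGx].
- by left; exact: Fx.
- by right; exact: Gx.
apply: contrapT => /not_orP[].
move=> /existsNP[i /not_implyP[_ nFx]] /existsNP[j /not_implyP[_ nGx]].
by have := FGx (pickle (i, j)) Logic.I; rewrite /pair pickleK /= => -[].
Qed.

Lemma Fsigmadelta_preimage (U : topologicalType) (f : U -> T) S :
  continuous f -> Fsigmadelta S -> Fsigmadelta (f @^-1` S).
Proof.
move=> f_cont [F F_sigma ->].
exists (fun i => f @^-1` F i); last exact: preimage_bigcap.
move=> i; have [G G_closed ->] := F_sigma i.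
exists (fun j => f @^-1` G j); last exact: preimage_bigcup.
by move=> j; apply: closed_comp => // x _; exact: f_cont.
Qed.

End Borel_class.

Lemma cantor_space_near (x : cantor_space) N :
  \forall y \near x, forall i, (i < N)%N -> y i = x i.
Proof.
elim: N => [|N IH]; first exact: filterE.
have xN : nbhs x [set y : cantor_space | y N = x N].
  apply: (@proj_continuous nat (fun=> bool) N x [set x N]).
  exact: discrete_set1.
move: IH xN; apply: filterS2 => y yx yN i.
rewrite ltnS leq_eqVlt => /orP[/eqP->|]//.
exact: yx.
Qed.

Definition cantor_compl (x : cantor_space) : cantor_space := fun n => ~~ x n.

Lemma continuous_cantor_compl : continuous cantor_compl.
Proof.
move=> x; apply/cvg_sup => i U [V [[W _ <-] /= Wxi WU]].
apply: filterS (cantor_space_near x i.+1) => y yx; apply: WU.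
by rewrite /= /cantor_compl yx.
Qed.

Lemma Fsigmadelta_ideal_algebra (Z : set (set nat)) (Z_ideal : set_ideal Z) :
  Fsigmadelta (char_set Z) -> Fsigmadelta (char_set (ideal_algebra Z_ideal)).
Proof.
move=> Z_Fsd.
rewrite (_ : char_set _ = char_set Z `|` cantor_compl @^-1` char_set Z).
  apply: FsigmadeltaU => //.
  exact: Fsigmadelta_preimage continuous_cantor_compl Z_Fsd.
have complE (x : cantor_space) : [set n | cantor_compl x n] = ~` [set n | x n].
  by apply/seteqP; split => n /negP.
by apply/seteqP; split => x; rewrite /char_set /= complE.
Qed.

Lemma Fsigma_near_count_below_le (D : set nat) (k : nat) :
  Fsigma [set x : cantor_space |
    \forall N \near \oo, D N -> (k * count_below [set i | x i] N <= N)%N].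
Proof.
pose C m := [set x : cantor_space |
  forall N, (m <= N)%N -> D N -> (k * count_below [set i | x i] N <= N)%N].
exists C => [m x x_closure N mN DN|].
  have [y [y_le yx]] := x_closure _ (cantor_space_near x N).
  apply: leq_trans (y_le N mN DN); rewrite leq_mul2l; apply/orP; right.
  by apply: leq_count_below => i /= + /yx ->.
by apply/seteqP; split => x [m _ mP]; exists m.
Qed.

Theorem Fsigmadelta_density_algebra (D : set nat) :
  Fsigmadelta (char_set (density_algebra D)).
Proof.
apply: Fsigmadelta_ideal_algebra; eexists.
  exact: Fsigma_near_count_below_le D.
apply/seteqP; split => [x Zx k _|x Zx k]; first exact: Zx k.
exact: Zx k Logic.I.
Qed.

(** * Isomorphisms *)

Definition is_atom (d : Order.disp_t) (A : ctbDistrLatticeType d) (a : A) :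
    Prop :=
  a <> \bot%O /\ forall b, (b <= a)%O -> b <> \bot%O -> b = a.

Lemma meet_morph_le (d d' : Order.disp_t) (A : meetSemilatticeType d)
    (B : meetSemilatticeType d') (f : A -> B) :
  injective f -> {morph f : a b / (a `&` b)%O} -> {mono f : a b / (a <= b)%O}.
Proof. by move=> f_inj fI a b; rewrite !leEmeet -fI (inj_eq f_inj). Qed.

Lemma is_atom_morph (d d' : Order.disp_t) (A : ctbDistrLatticeType d)
    (B : ctbDistrLatticeType d') (f : A -> B) (a : A) :
    bijective f -> f \bot%O = \bot%O -> {morph f : a b / (a `&` b)%O} ->
  is_atom (f a) <-> is_atom a.
Proof.
move=> [g fK gK] f0 fI; have f_inj := can_inj fK.
have f_le := meet_morph_le f_inj fI.
have f_neq0 b : f b <> \bot%O <-> b <> \bot%O.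
  by rewrite -f0; split=> b_neq0 => [b0|/f_inj//]; apply: b_neq0; rewrite b0.
split=> -[/f_neq0 a_neq0 a_min]; split => //.
- move=> b ba /f_neq0 b_neq0; apply: f_inj.
  by apply: a_min => //; rewrite f_le.
- by move=> b; rewrite -[b]gK f_le => ba /f_neq0 b_neq0; congr f; exact: a_min.
Qed.

Lemma is_atomP (S : subalgebra) (S_set1 : forall i, carrier S [set i])
    (a : elements S) :
  is_atom a <-> exists i, a = singleton S_set1 i.
Proof.
split => [[/elements_neq0P[i ai] a_min]|[i ->]].
  exists i; apply/esym/a_min; first exact/singleton_le.
  by apply/elements_neq0P; exists i.
split => [|b /elements_leP bi /elements_neq0P[j bj]].
  by apply/elements_neq0P; exists i.
by apply: val_inj; apply/seteqP; split => // _ ->; rewrite -(bi j bj).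
Qed.

Theorem isomorphic_bijection (S T : subalgebra) :
    (forall i, carrier S [set i]) -> (forall i, carrier T [set i]) ->
    boolalg_isomorphic (elements S) (elements T) ->
  exists2 p : nat -> nat, bijective p &
    forall A, carrier T (p @` A) <-> carrier S A.
Proof.
move=> S_set1 T_set1 [f [f_bij [f0 _] fI _ _]].
have f_atom a := is_atom_morph a f_bij f0 fI; have [g fK gK] := f_bij.
have /choice[p pP] i : exists j, f (singleton S_set1 i) = singleton T_set1 j.
  by apply/is_atomP/f_atom/is_atomP; exists i.
have /choice[q qP] j : exists i, f (singleton S_set1 i) = singleton T_set1 j.
  have /is_atomP[i gi] : is_atom (g (singleton T_set1 j)).
    by apply/f_atom; rewrite gK; apply/is_atomP; exists j.
  by exists i; rewrite -gi gK.
have pK : cancel p q.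
  move=> i; apply: (@singleton_inj S S_set1); apply: (can_inj fK).
  by rewrite qP pP.
have qK : cancel q p.
  by move=> j; apply: (@singleton_inj T T_set1); rewrite -pP qP.
have f_image a : element_val (f a) = p @` element_val a.
  have f_mem i : element_val (f a) (p i) <-> element_val a i.
    rewrite -(singleton_le T_set1) -(singleton_le S_set1) -pP.
    by rewrite (meet_morph_le (can_inj fK) fI).
  apply/seteqP; split => [j|_ [i ai <-]]; last exact/f_mem.
  by rewrite -[j]qK => /f_mem ?; exists (q j).
exists p; first by exists q.
move=> A; split => [TA|SA].
  suff <- : element_val (g (Element (mem_set TA))) = A.
    exact: set_mem (valP _).
  have p_inj := can_inj pK; apply/funext => i.
  by rewrite -[LHS](image_inj p_inj) -f_image gK; exact: image_inj.
rewrite -[A]/(element_val (Element (mem_set SA))) -f_image.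
exact: set_mem (valP _).
Qed.

Section lacunary.
Variable u : nat -> nat.
Hypothesis u_incr : {homo u : m n / (m < n)%N}.
Hypothesis u_lacunary : forall k, \forall n \near \oo, (k * u n <= u n.+1)%N.

Let u_ge n : (n <= u n)%N.
Proof. by elim: n => // n /leq_ltn_trans; apply; exact: u_incr. Qed.

Let u_mono : {mono u : m n / (m <= n)%N}.
Proof. exact: leq_mono. Qed.

Lemma density_zero_image (X A : set nat) : density_zero (u @` X) A <->
  forall k, \forall n \near \oo, X n -> (k * count_below A (u n) <= u n)%N.
Proof.
split => ZA k; have [M _ MP] := ZA k.
  by exists M => // n /= Mn Xn; apply: MP; [exact: leq_trans (u_ge n)|exists n].
exists (u M) => // N /= uMN [n Xn unN]; rewrite -unN in uMN *.
by apply: MP => //=; rewrite -u_mono.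
Qed.

(* For [m.+1] in [X `\` Y] almost all even numbers below [u m.+1] belong to the
   set; their images are at least [u m], so that along [Y] they first count at
   [u m.+2] or later, where these at most [u m.+1] numbers are negligible. *)
Definition diagonal_set (X Y : set nat) (p : nat -> nat) : set nat :=
  residue_class 2 0 `&`
  [set i | exists m, [/\ (X `\` Y) m.+1, (i < u m.+1)%N & (u m <= p i)%N]].

Lemma density_zero_image_diagonal_set (X Y : set nat) (p : nat -> nat) :
  bijective p -> density_zero (u @` Y) (p @` diagonal_set X Y p).
Proof.
move=> [q pK qK]; apply/density_zero_image => k.
have [M _ MP] := u_lacunary k; exists M.+1 => // -[//|l] /= Ml Yl.
apply: leq_trans (MP l Ml); rewrite leq_mul2l; apply/orP; right.
rewrite -[leqRHS]count_belowT.
apply: (leq_count_below_inj (p := q)) => [i j _ _ /(can_inj qK)//|].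
move=> _ [i [_ [m [[_ nYm] im mi]]] <-] il.
split => //; rewrite pK; apply: leq_trans im _; rewrite u_mono.
have : (m < l.+1)%N by rewrite -(leqW_mono u_mono) (leq_ltn_trans mi).
by rewrite ltnS leq_eqVlt => /orP[/eqP ml|//]; case: nYm; rewrite ml.
Qed.

Lemma count_below_diagonal_set_ge (X Y : set nat) (p : nat -> nat) (m : nat) :
    injective p -> (X `\` Y) m.+1 ->
  (count_below (residue_class 2 0) (u m.+1) <=
   count_below (diagonal_set X Y p) (u m.+1) + u m)%N.
Proof.
move=> p_inj XYm; pose B := [set i | (p i < u m)%N].
apply: (@leq_trans (count_below (diagonal_set X Y p) (u m.+1) +
                    count_below B (u m.+1))).
  apply: leq_trans (count_belowU _ _ _).
  apply: leq_count_below => i i_even i_lt.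
  have [pi|pi] := ltnP (p i) (u m); [by right|left; split => //].
  by exists m.
rewrite leq_add2l -[leqRHS]count_belowT.
by apply: (leq_count_below_inj (p := p)) => // i j _ _; exact: p_inj.
Qed.

Lemma diagonal_set_notin_density_algebra (X Y : set nat) (p : nat -> nat) :
    infinite_set (X `\` Y) -> injective p ->
  ~ carrier (density_algebra (u @` X)) (diagonal_set X Y p).
Proof.
move=> XY_inf p_inj; set A := diagonal_set X Y p.
have odd_sub : ~` residue_class 2 0 `<=` residue_class 2 1.
  by move=> i; rewrite /residue_class /= modn2; case: odd.
have evenC n := count_belowC (residue_class 2 0) (u n).
case=> /density_zero_image/(_ 4%N) ZA.
- have u_far : \forall n \near \oo, (8 * u n.-1 <= u n)%N.
    by apply: near_inftyS; exact: u_lacunary.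
  have [n [Xn nYn] [n_gt8 [/(_ Xn) A_le u_le]]] := infinite_set_near XY_inf
    (filterI (nbhs_infty_gt 8) (filterI ZA u_far)).
  case: n => // n in Xn nYn n_gt8 A_le u_le *.
  have un_gt8 := leq_trans n_gt8 (u_ge n.+1); rewrite /= in u_le.
  have := count_below_diagonal_set_ge p_inj (conj Xn nYn); rewrite -/A.
  have := count_below_residue 1 (u n.+1) (isT : 0 < 2)%N.
  by have := sub_count_below (u n.+1) odd_sub; have := evenC n.+1; lia.
- have [n [Xn _] [n_gt8 /(_ Xn) A_le]] :=
    infinite_set_near XY_inf (filterI (nbhs_infty_gt 8) ZA).
  have un_gt8 := leq_trans n_gt8 (u_ge n).
  have A_even : ~` residue_class 2 0 `<=` ~` A by apply: subsetC => i [].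
  have := count_below_residue 0 (u n) (isT : 0 < 2)%N.
  by have := sub_count_below (u n) A_even; have := evenC n; lia.
Qed.

Theorem density_algebra_not_isomorphic (X Y : set nat) :
    infinite_set (X `\` Y) ->
  ~ boolalg_isomorphic (elements (density_algebra (u @` X)))
                       (elements (density_algebra (u @` Y))).
Proof.
have set1 D i : carrier (density_algebra D) [set i].
  by apply: ideal_algebra_set1 => j; exact: density_zero_finite.
move=> XY_inf /isomorphic_bijection[||p p_bij pE]; [exact: set1..|].
apply: (diagonal_set_notin_density_algebra XY_inf (bij_inj p_bij)).
by apply/pE; left; exact: density_zero_image_diagonal_set.
Qed.

End lacunary.

(** * A continuum of algebras *)

Lemma infinite_image_inj (T U : Type) (f : T -> U) (A : set T) :
  injective f -> infinite_set A -> infinite_set (f @` A).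
Proof.
move=> f_inj A_inf; rewrite (eq_finite_set (inj_card_eq _)) => // x y _ _.
exact: f_inj.
Qed.

(* The component [x.1] makes the difference of two distinct graphs infinite. *)
Definition cut_graph (R : realType) (r : R) : set nat :=
  range (fun x : nat * rat => pickle (x, ratr x.2 < r)).

Lemma infinite_cut_graph_setD (R : realType) (r t : R) : r != t ->
  infinite_set (cut_graph r `\` cut_graph t).
Proof.
move=> rt; have [q q_sep] : exists q : rat, (ratr q < r) <> (ratr q < t).
  move: rt; rewrite neq_lt => /orP[] /rat_in_itvoo[q];
    rewrite in_itv /= => /andP[q1 q2];
    by exists q; rewrite q2 ltNge (ltW q1).
pose code (n : nat) := pickle (n, q, ratr q < r).
have code_sub : range code `<=` cut_graph r `\` cut_graph t.
  move=> _ [n _ <-]; split; first by exists (n, q).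
  by move=> [[m s] _ /(pcan_inj pickleK)[_ -> /esym]].
apply: (sub_infinite_set code_sub); apply: infinite_image_inj infinite_nat.
by move=> m n /(pcan_inj pickleK)[].
Qed.

Lemma infinite_cut_graph (R : realType) (r : R) : infinite_set (cut_graph r).
Proof.
have /infinite_cut_graph_setD : r != r + 1 by rewrite lt_eqF// ltrDl.
by apply: sub_infinite_set; exact: subDsetl.
Qed.

Lemma ltn_factS : {homo (fun n => n.+1`!) : m n / (m < n)%N}.
Proof. by move=> m n mn; exact: ltn_fact. Qed.

Definition cut_algebra (R : realType) (r : R) : subalgebra :=
  density_algebra ((fun n => n.+1`!) @` cut_graph r).

Lemma cut_algebra_not_isomorphic (R : realType) (r t : R) : r != t ->
  ~ boolalg_isomorphic (elements (cut_algebra r)) (elements (cut_algebra t)).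
Proof.
move=> /infinite_cut_graph_setD.
apply: (density_algebra_not_isomorphic ltn_factS) => k.
exists k => // n /= kn; rewrite [leqRHS]factS leq_mul2r.
by rewrite (leq_trans kn) ?orbT// ltnW.
Qed.

Lemma cut_algebra_not_Grothendieck (R : realType) (r : R) :
  ~ Grothendieck_property R (elements (cut_algebra r)).
Proof.
apply: density_algebra_not_Grothendieck.
apply: infinite_image_inj (@infinite_cut_graph R r).
exact: incn_inj (leq_mono ltn_factS).
Qed.

Theorem theoremA (R : realType) :
  exists H1 : set subalgebra,
    [/\ (H1 #= [set: R])%card,
        (forall S T : subalgebra, H1 S -> H1 T -> S <> T ->
          ~ boolalg_isomorphic (elements S) (elements T)),
        (forall S : subalgebra, H1 S -> Fsigmadelta (char_set S)) &
        (forall S : subalgebra, H1 S ->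
          Nikodym_property R (elements S) /\
          ~ Grothendieck_property R (elements S))].
Proof.
pose A (r : R) := cut_algebra r.
have A_inj : injective A.
  move=> r t Art; apply/eqP/negPn/negP => /cut_algebra_not_isomorphic; apply.
  by rewrite -/(A r) Art; exists id; split => //; exists id.
exists (range A); split.
- by apply: inj_card_eq => r t _ _; exact: A_inj.
- move=> _ _ [r _ <-] [t _ <-] Art; apply: cut_algebra_not_isomorphic.
  by apply/eqP => rt; apply: Art; rewrite rt.
- by move=> _ [r _ <-]; exact: Fsigmadelta_density_algebra.
- move=> _ [r _ <-]; split; first exact: density_algebra_Nikodym.
  exact: cut_algebra_not_Grothendieck.
Qed.
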